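(* Let $\alpha\in\mathbb{R}$ be arbitrarily fixed and assume that the function $f:]0,1]\rightarrow\mathbb{R}$ fulfills $$f(xy)=y^{\alpha}f(x)+x^{\alpha}f(y)$$ for all $x,y\in ]0,1]$. Suppose further that one of the following statements is true: (i) $f$ is bounded above or bounded below on a subset of $]0,1[$ that has positive Lebesgue measure; (ii) $f$ is Lebesgue measurable. Then there exists $c\in\mathbb{R}$ such that $$f(x)=cx^{\alpha}\ln(x)\qquad \text{for all } x\in ]0,1].$$
   Context: The notation $]a,b[$ and $]a,b]$ denotes open and left-open, right-closed intervals. *)

(* Defs.v *)
From mathcomp Require Import all_boot all_order all_algebra.
From mathcomp Require Import all_classical all_reals all_analysis.

Set Implicit Arguments.
Unset Strict Implicit.
Unset Printing Implicit Defensive.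

Import Order.TTheory GRing.Theory Num.Theory.
Import numFieldNormedType.Exports.

Local Open Scope classical_set_scope.
Local Open Scope ring_scope.

(* The reals with the sigma-algebra of Lebesgue measurable sets, i.e. the
   domain of [completed_lebesgue_measure]. The canonical sigma-algebra on R is
   the strictly smaller Borel one, so measurability of sets and functions in
   the sense of Lebesgue has to be taken relative to this type. *)
Notation lebesgueType R := (caratheodory_type (wlength (@idfun R))^*%mu).

Definition lebesgue_measurable_set (R : realType) (A : set R) : Prop :=
  measurable (A : set (lebesgueType R)).

(* The codomain carries the Borel sigma-algebra. *)
Definition lebesgue_measurable_fun (R : realType) (D : set R) (f : R -> R) :
    Prop :=
  measurable_fun (D : set (lebesgueType R))
    (f : lebesgueType R -> measurableTypeR R).

(* Main.v *)
Require Import Defs.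
From mathcomp Require Import all_boot all_order all_algebra.
From mathcomp Require Import all_classical all_reals all_analysis.
From mathcomp Require Import measurable_realfun ring lra.

Import Order.TTheory GRing.Theory Num.Theory.
Import numFieldNormedType.Exports.

Local Open Scope classical_set_scope.
Local Open Scope ring_scope.

Set Implicit Arguments.
Unset Strict Implicit.

(** Dividing by [x `^ alpha] turns the equation into
    [h (x * y) = h x + h y] for [h x := f x / x `^ alpha], so that
    [g t := h (expR (- t))] is additive on the half-line [0 <= t]. An additive
    function on the half-line which is bounded below on one interval [[0, T]] is
    linear ([additive_bounded_below_linear]), and [g t = b * t] means
    [f x = - b * x `^ alpha * ln x]. It remains to find a lower bound of [h] on
    [[1/2, 1]].

    Suppose that [f] is bounded above on a set [A] of positive measure, but that
    [h (u n) < - n] for some [u n] in [[1/2, 1]]. The scaled sets [u n * A] all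
    lie in the open unit interval and have measure at least half that of [A], so
    some point [x] belongs to infinitely many of them ([scaled_copies_meet]). For these [n]
    we have [h x = h (u n) + h (x / u n)] with [x / u n] in [A]; the last term is
    bounded above uniformly in [n], because [f] is bounded above on [A] and
    [x / u n] stays in [[x, 1]]. Letting [n] grow contradicts the finiteness of
    [h x] ([div_powR_bounded_below]).

    The other two cases reduce to this one: a lower bound of [f] is an upper
    bound of [- f], which solves the same equation, and a measurable [f] is
    bounded above on each of the sets where [f <= n], which exhaust the domain and
    so cannot all be null. *)

(** * Infinitely recurring scaled copies of a set *)

(** The measures of the tail unions decrease to that of the upper limit as soon
    as one of them is finite, and each tail union contains some [F k]. *)
Lemma le_measure_lim_sup_set d (T : measurableType d) (R : realType)
    (mu : {measure set T -> \bar R}) (F : (set T)^nat) (c : \bar R) :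
  (forall k, measurable (F k)) -> (mu (\bigcup_k F k) < +oo)%E ->
  (forall k, c <= mu (F k))%E -> (c <= mu (lim_sup_set F))%E.
Proof.
move=> mF Foo cF.
have Foo0 : (mu (\bigcup_(k >= 0) F k) < +oo)%E.
  apply: le_lt_trans Foo; apply: le_measure; rewrite ?inE//.
  - exact: bigcup_measurable.
  - exact: bigcup_measurable.
  - by move=> x [k _ Fx]; exists k.
have cv := lim_sup_set_cvg mu F mF Foo0.
rewrite -(cvg_lim _ cv)//.
apply: lime_ge; first by apply/cvg_ex; eexists; exact: cv.
apply: nearW => n; apply: (le_trans (cF n)).
apply: le_measure; rewrite ?inE//; first exact: bigcup_measurable.
by move=> x Fx; exists n => /=.
Qed.

(** By uniqueness of Lebesgue measure it suffices to compare the two sides, as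
    measures of [A], on half-open intervals. *)
Lemma lebesgue_measure_preimage_mulr (R : realType) (k : R) (A : set R) :
  0 < k -> measurable A ->
  lebesgue_measure ((fun x => x * k) @^-1` A) = (k^-1%:E * lebesgue_measure A)%E.
Proof.
move=> k0 mA.
have mk : measurable_fun setT
    ((fun x => x * k) : measurableTypeR R -> measurableTypeR R).
  exact: mulrr_measurable.
have knz : k != 0 by rewrite gt_eqF.
have k0' : 0 <= k by exact: ltW.
pose nu := mscale (NngNum k0') (pushforward (@lebesgue_measure R)
  ((fun x => x * k) : measurableTypeR R -> measurableTypeR R)).
have -> : lebesgue_measure A = nu mk A.
  apply: lebesgue_measure_unique => //= _ [[a b]] _ <-.
  rewrite /nu /mscale/= /pushforward/=.
  have -> : (fun x => x * k) @^-1` `]a, b]%classic =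
      `](a / k), (b / k)]%classic.
    by apply/seteqP; split => x /=; rewrite !in_itv/= ltr_pdivrMr// ler_pdivlMr.
  rewrite !lebesgue_measure_itv/= !lte_fin ltr_pM2r ?invr_gt0//.
  case: ifPn => _; last by rewrite mule0.
  by rewrite -!EFinD -EFinM; congr EFin; field.
rewrite /nu /mscale/= /pushforward/= muleA -EFinM mulVf//.
by rewrite mul1e.
Qed.

(** A Lebesgue measurable set is the union of a Borel set and a null set. This
    lets the measure-theoretic argument take place on Borel sets, where
    uniqueness of Lebesgue measure is available. *)
Lemma lebesgue_measurable_Borel_core (R : realType) (A : set R) :
  lebesgue_measurable_set A -> (0 < completed_lebesgue_measure A)%E ->
  exists B : set (measurableTypeR R),
    [/\ measurable B, B `<=` A & (0 < lebesgue_measure B)%E].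
Proof.
rewrite /lebesgue_measurable_set => mA A0.
have : (completed_algebra_gen (@lebesgue_measure R)).-sigma.-measurable A.
  by rewrite completed_caratheodory_measurable.
rewrite g_sigma_completed_algebra_genE => -[B mB [N [C [mC C0 NC]] BNA]].
exists B; split => //; first by rewrite -BNA; exact: subsetUl.
apply: (lt_le_trans A0).
rewrite -BNA.
apply: (@le_trans _ _ (lebesgue_measure (B `|` C))).
  by apply: le_outer_measure; exact: setUS.
apply: (le_trans (measureU2 lebesgue_measure mB mC)).
by rewrite [X in (_ + X)%E]C0 adde0.
Qed.

(** Scaling by [u n >= 1/2] at most halves the measure and [u n <= 1] keeps the
    copies [u n * B] inside the unit interval, so their upper limit has positive
    measure and is inhabited; membership of [x] in [u n * B] reads [B (x / u n)]. *)
Lemma scaled_copies_meet (R : realType) (B : set (measurableTypeR R))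
    (u : nat -> R) :
  measurable B -> B `<=` `]0, 1[ -> (0 < lebesgue_measure B)%E ->
  (forall n, u n \in `[2^-1, 1]) ->
  exists x : R, forall n, exists2 j, (n <= j)%N & B (x / u j).
Proof.
move=> mB B01 B0 u12.
have u0 n : 0 < u n.
  have := u12 n; rewrite in_itv/= => /andP[+ _].
  by apply: lt_le_trans; rewrite invr_gt0.
pose F n : set (measurableTypeR R) := (fun x => x * (u n)^-1) @^-1` B.
have mF n : measurable (F n).
  by rewrite -[F n]setTI; apply: mulrr_measurable.
have F01 n : F n `<=` `]0, 1[.
  move=> x /B01; rewrite /= !in_itv/= => /andP[x0 x1].
  have := u12 n; rewrite in_itv/= => /andP[_ u1].
  rewrite pmulr_lgt0 ?invr_gt0// in x0.
  rewrite ltr_pdivrMr// mul1r in x1.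
  by rewrite x0 (lt_le_trans x1).
have : (2^-1%:E * lebesgue_measure B <= lebesgue_measure (lim_sup_set F))%E.
  apply: le_measure_lim_sup_set => //.
    apply: (@le_lt_trans _ _ (lebesgue_measure (`]0, 1[%classic : set R))).
      apply: le_measure; rewrite ?inE//; first exact: bigcup_measurable.
      by apply: bigcup_sub => n _; exact: F01.
    by rewrite lebesgue_measure_itv/= lte01 -EFinD ltry.
  move=> n.
  have muF : lebesgue_measure (F n) = ((u n)%:E * lebesgue_measure B)%E.
    by rewrite [LHS]lebesgue_measure_preimage_mulr ?invr_gt0// invrK.
  rewrite [leRHS]muF.
  apply: lee_wpmul2r => //; rewrite lee_fin.
  by have := u12 n; rewrite in_itv/= => /andP[].
have := @set0P _ (lim_sup_set F).
case: (eqVneq (lim_sup_set F) set0) => [-> _|_ ].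
  by rewrite measure0 leNgt mule_gt0// lte_fin invr_gt0.
move=> /iffLR /(_ isT) [x Fx] _; exists x => n.
by have [j /= nj Fj] := Fx n I; exists j.
Qed.

(** * Additive functions on the half-line *)

(** Subtract the linear function with the same value at [T]: the difference [k]
    is additive and vanishes at [T], hence is [T]-periodic. On [[0, T]] it is
    bounded below, and above since [k t = - k (T - t)], so by periodicity it is
    bounded everywhere. But [k (n t) = n k t], which forces [k = 0]. *)
Lemma additive_bounded_below_linear (R : realType) (g : R -> R) (T C : R) :
  (forall s t, 0 <= s -> 0 <= t -> g (s + t) = g s + g t) ->
  0 < T -> (forall t, 0 <= t <= T -> C <= g t) ->
  forall t, 0 <= t -> g t = g T / T * t.
Proof.
move=> gD T0 gC.
pose k t := g t - g T / T * t.
have kD s t : 0 <= s -> 0 <= t -> k (s + t) = k s + k t.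
  by move=> s0 t0; rewrite /k gD//; ring.
have kMn n t : 0 <= t -> k (t *+ n) = k t *+ n.
  move=> t0; elim: n => [|n IH].
    have := kD 0 0 (lexx _) (lexx _); rewrite addr0 !mulr0n => ?; lra.
  by rewrite !mulrS kD ?IH// mulrn_wge0.
have kT : k T = 0 by rewrite /k mulfVK ?subrr// gt_eqF.
pose D := `|C| + `|g T|.
have klow t : 0 <= t <= T -> - D <= k t.
  move=> tT; have := gC t tT; have /andP[t0 t1] := tT.
  have : g T / T * t <= `|g T|.
    apply: le_trans (ler_norm _) _; rewrite !normrM -mulrA ler_piMr//.
    by rewrite (ger0_norm t0) gtr0_norm ?invr_gt0// mulrC ler_pdivrMr// mul1r.
  have := ler_norm (- C); rewrite normrN /k /D => *; lra.
have kabs t : 0 <= t <= T -> `|k t| <= D.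
  move=> tT; have /andP[t0 t1] := tT.
  have tT' : 0 <= T - t <= T by apply/andP; split; lra.
  have Tt0 : 0 <= T - t by case/andP: tT'.
  have := kD _ _ t0 Tt0; rewrite subrKC kT => kk.
  have := klow _ tT; have := klow _ tT'; rewrite ler_norml => *.
  by apply/andP; split; lra.
have kall t : 0 <= t -> `|k t| <= D.
  move=> t0; have tT0 : 0 <= t / T by rewrite divr_ge0// ltW.
  have /andP[n1 n2] := truncn_itv tT0; set n := Num.truncn _ in n1 n2.
  rewrite ler_pdivlMr// in n1; rewrite ltr_pdivrMr// in n2.
  rewrite -natr1 in n2.
  have r0 : 0 <= t - n%:R * T by lra.
  have nT0 : 0 <= n%:R * T by rewrite mulr_ge0// ltW.
  have -> : k t = k (t - n%:R * T).
    have := kD _ _ r0 nT0; rewrite subrK => ->.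
    by rewrite mulr_natl kMn ?(ltW T0)// kT mul0rn addr0.
  by apply: kabs; apply/andP; split; lra.
move=> t t0; apply/eqP; rewrite -subr_eq0 -/(k t).
apply/negPn/negP => kt0.
have nk : 0 < `|k t| by rewrite normr_gt0.
have [n Dn] : exists n, D / `|k t| < n%:R.
  by exists (Num.truncn (D / `|k t|)).+1; apply: truncnS_gt.
rewrite ltr_pdivrMr// mulr_natl in Dn.
have := kall (t *+ n) (mulrn_wge0 _ t0).
by rewrite kMn// normrMn leNgt Dn.
Qed.

(** * Lower bound of the normalised solution *)

Lemma div_powR_additive (R : realType) (alpha : R) (f : R -> R) :
  (forall x y : R, x \in `]0, 1] -> y \in `]0, 1] ->
     f (x * y) = y `^ alpha * f x + x `^ alpha * f y) ->
  forall x y : R, x \in `]0, 1] -> y \in `]0, 1] ->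
    f (x * y) / (x * y) `^ alpha = f x / x `^ alpha + f y / y `^ alpha.
Proof.
move=> f_eq x y x01 y01; rewrite f_eq//.
move: x01 y01; rewrite !in_itv/= => /andP[x0 _] /andP[y0 _].
rewrite powRM ?ltW//.
by field; rewrite !gt_eqF ?powR_gt0.
Qed.

(** Since [0 <= - ln a <= - ln x], the exponent [- alpha * ln a] is controlled
    without knowing the sign of [alpha]; the bound must not involve [a], which
    will run along a sequence of points above a fixed [x]. *)
Lemma powR_inv_le (R : realType) (alpha a x : R) :
  0 < x -> x <= a -> a <= 1 -> (a `^ alpha)^-1 <= expR (`|alpha| * - ln x).
Proof.
move=> x0 xa a1; have a0 : 0 < a by exact: lt_le_trans xa.
rewrite -powRN /powR gt_eqF// ler_expR mulNr -mulrN.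
have la : 0 <= - ln a by rewrite oppr_ge0 ln_le0.
apply: (@le_trans _ _ (`|alpha| * - ln a)); first by rewrite ler_wpM2r// ler_norm.
by rewrite ler_wpM2l// lerN2 ler_ln// posrE.
Qed.

(** If the quotient were unbounded below along [u n], a point [x] lying in
    infinitely many [u n * A] would have a quotient smaller than any real. *)
Lemma div_powR_bounded_below (R : realType) (alpha : R) (f : R -> R)
    (A : set R) :
  (forall x y : R, x \in `]0, 1] -> y \in `]0, 1] ->
     f (x * y) = y `^ alpha * f x + x `^ alpha * f y) ->
  A `<=` `]0, 1[ -> lebesgue_measurable_set A ->
  (0 < completed_lebesgue_measure A)%E -> has_ubound (f @` A) ->
  exists C : R, forall u, u \in `[2^-1, 1] -> C <= f u / u `^ alpha.
Proof.
move=> f_eq A01 mA A0 [M fM].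
have [B [mB BA B0]] := lebesgue_measurable_Borel_core mA A0.
apply: contrapT => noC.
have /choice[u u_n] n : exists v, v \in `[2^-1, 1] /\ f v / v `^ alpha < - n%:R.
  apply: contrapT => nov; apply: noC; exists (- n%:R) => v v12.
  by rewrite leNgt; apply/negP => vn; apply: nov; exists v.
have [x xB] :=
  scaled_copies_meet mB (subset_trans BA A01) B0 (fun n => (u_n n).1).
(* [K] bounds the quotient at every point of [A] in [[x, 1]]. *)
pose K := `|M| * expR (`|alpha| * - ln x).
pose n := (Num.truncn (K - f x / x `^ alpha)).+1.
have [j nj Bj] := xB n.
have [uj uj_lt] := u_n j; set v := u j in Bj uj uj_lt.
have /A01 := BA _ Bj; set a := x / v in Bj *.
move: uj; rewrite /= !in_itv/= => /andP[v2 v1] /andP[a0 a1].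
have v0 : 0 < v by apply: lt_le_trans v2; rewrite invr_gt0.
have xE : v * a = x by rewrite mulrC divfK// gt_eqF.
have x0 : 0 < x by rewrite -xE mulr_gt0.
have xa : x <= a by rewrite -xE ler_piMl// ltW.
have := div_powR_additive f_eq (x := v) (y := a).
rewrite !in_itv/= v0 v1 a0 (ltW a1) xE => /(_ isT isT) hx.
have fa : f a / a `^ alpha <= K.
  apply: (@le_trans _ _ (`|M| / a `^ alpha)).
    rewrite ler_wpM2r// ?invr_ge0 ?powR_ge0//.
    by rewrite (le_trans _ (ler_norm M))//; apply: fM; exists a => //; exact: BA.
  by rewrite ler_wpM2l//; apply: powR_inv_le => //; exact: ltW.
have nx : K - f x / x `^ alpha < n%:R by exact: truncnS_gt.
have : (n%:R : R) <= j%:R by rewrite ler_nat.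
lra.
Qed.

(** * The three regularity assumptions *)

Lemma bounded_above_powR_ln (R : realType) (alpha : R) (f : R -> R)
    (A : set R) :
  (forall x y : R, x \in `]0, 1] -> y \in `]0, 1] ->
     f (x * y) = y `^ alpha * f x + x `^ alpha * f y) ->
  A `<=` `]0, 1[ -> lebesgue_measurable_set A ->
  (0 < completed_lebesgue_measure A)%E -> has_ubound (f @` A) ->
  exists c : R, forall x : R, x \in `]0, 1] -> f x = c * x `^ alpha * ln x.
Proof.
move=> f_eq A01 mA A0 fA.
have [C hC] := div_powR_bounded_below f_eq A01 mA A0 fA.
pose g t := f (expR (- t)) / expR (- t) `^ alpha.
have e01 (t : R) : 0 <= t -> expR (- t) \in `]0, 1].
  by move=> t0; rewrite in_itv/= expR_gt0 -[leRHS]expR0 ler_expR oppr_le0.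
have gD (s t : R) : 0 <= s -> 0 <= t -> g (s + t) = g s + g t.
  by move=> s0 t0; rewrite /g opprD expRD div_powR_additive// e01.
(* [T = ln 2] because [expR (- t)] runs through [[1/2, 1]] on [[0, ln 2]]. *)
have ln2_gt0 : 0 < ln 2 :> R by rewrite ln_gt0// ltr1n.
have gC (t : R) : 0 <= t <= ln 2 -> C <= g t.
  move=> /andP[t0 t2]; apply: hC.
  rewrite in_itv/=; have := e01 t t0; rewrite in_itv/= => /andP[_ ->].
  by rewrite andbT expRN lef_pV2 ?posrE ?expR_gt0// -[leRHS]lnK ?posrE// ler_expR.
exists (- (g (ln 2) / ln 2)) => x; rewrite in_itv/= => /andP[x0 x1].
have lx : 0 <= - ln x by rewrite oppr_ge0 ln_le0.
have := additive_bounded_below_linear gD ln2_gt0 gC lx.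
rewrite {1}/g opprK lnK ?posrE// => /(canRL (divfK _)) ->.
  by ring.
by rewrite gt_eqF// powR_gt0.
Qed.

(** The sets where [f <= n] cover the open unit interval, so by countable
    subadditivity they are not all null. *)
Lemma lebesgue_measurable_bounded_above (R : realType) (f : R -> R) :
  lebesgue_measurable_fun `]0, 1] f ->
  exists A : set R, [/\ A `<=` `]0, 1[, lebesgue_measurable_set A,
    (0 < completed_lebesgue_measure A)%E & has_ubound (f @` A)].
Proof.
move=> mf.
have mB (D : set (measurableTypeR R)) : measurable D -> lebesgue_measurable_set D.
  by move=> mD; exact: sub_caratheodory.
pose A n : set (lebesgueType R) :=
  `]0, 1[ `&` (`]0, 1] `&` f @^-1` `]-oo, n%:R]).
have mA n : measurable (A n).
  apply: measurableI; first by apply: mB; exact: measurable_itv.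
  by apply: (mf (mB _ (measurable_itv _))); exact: measurable_itv.
have [[n A0]|noA] := pselect (exists n, 0 < completed_lebesgue_measure (A n))%E.
  exists (A n); split; [exact: subIsetl|exact: mA|exact: A0|].
  exists n%:R => /= _ [x [_ [_ +]] <-].
  by rewrite /= in_itv.
have AU : `]0, 1[%classic `<=` \bigcup_n A n.
  move=> x /= x01; exists (Num.truncn (f x)).+1 => //; split => //; split.
    exact: subset_itv_oo_oc x01.
  by rewrite /= in_itv/= ltW// truncnS_gt.
have A0 n : completed_lebesgue_measure (A n) = 0%E.
  apply/eqP; rewrite eq_le measure_ge0 andbT leNgt; apply/negP => ?.
  by apply: noA; exists n.
have m01 : lebesgue_measurable_set (`]0, 1[%classic : set R).
  by apply: mB; exact: measurable_itv.
have mu01 : (0 < completed_lebesgue_measure (`]0%R, 1%R[%classic : set R))%E.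
  (* Both measures are restrictions of one outer measure. *)
  change (0 < lebesgue_measure (`]0%R, 1%R[%classic : set R))%E.
  by rewrite lebesgue_measure_itv/= lte01 -EFinD lte_fin subr0 ltr01.
have := measure_sigma_subadditive completed_lebesgue_measure mA m01 AU.
rewrite eseries0; last by move=> n _ _; exact: A0.
by move/(lt_le_trans mu01); rewrite ltxx.
Qed.

Unset Implicit Arguments.

Theorem corollary2p5 (R : realType) (alpha : R) (f : R -> R)
  (f_eq : forall x y : R, x \in `]0, 1] -> y \in `]0, 1] ->
     f (x * y) = y `^ alpha * f x + x `^ alpha * f y)
  (f_reg :
     (exists A : set R,
        [/\ A `<=` `]0, 1[,
            lebesgue_measurable_set A,
            (0 < completed_lebesgue_measure A)%E
          & has_ubound (f @` A) \/ has_lbound (f @` A)])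
     \/ lebesgue_measurable_fun `]0, 1] f) :
  exists c : R, forall x : R, x \in `]0, 1] -> f x = c * x `^ alpha * ln x.
Proof.
have [[A [A01 mA A0 [fA|[m fm]]]]|] := f_reg.
- exact: bounded_above_powR_ln f_eq A01 mA A0 fA.
- have [||c fc] := @bounded_above_powR_ln _ alpha (fun x => - f x) _ _ A01 mA A0.
  + by move=> x y x01 y01; rewrite f_eq//; ring.
  + by exists (- m) => _ [x Ax <-]; rewrite lerN2; apply: fm; exists x.
  + by exists (- c) => x /fc; rewrite !mulNr => <-; rewrite opprK.
- move=> /lebesgue_measurable_bounded_above[A [A01 mA A0 fA]].
  exact: bounded_above_powR_ln f_eq A01 mA A0 fA.
Qed.
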